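(* Let $S\subseteq[n-1]$ be $n$-admissible, and let $p$ be the peak polynomial of $S$. Then (I) $|P_C(S;n)| = p(n)\,2^{2n-|S|-1}$; (II) $|P_D(S;n)| = p(n)\,2^{2n-|S|-2}$.
   Context: Notation: $[n]=\{1,\dots,n\}$. $\mathfrak{S}_n$ is the symmetric group on $[n]$, with permutations written in one-line notation. For a sequence $w_1\cdots w_r$ of distinct integers, an index $i$ with $2\le i\le r-1$ is a peak if $w_{i-1}<w_i>w_{i+1}$, and $P(w_1\cdots w_r)$ denotes the set of peaks. Set $P(S;n)=\{\pi\in\mathfrak{S}_n\mid P(\pi)=S\}$; $S$ is $n$-admissible if $P(S;n)\neq\emptyset$. Peak polynomial (Billey, Burdzy, Sagan; a known result): for an admissible set $S$ there is a polynomial $p$, depending only on $S$, of degree $\max(S)-1$ (constant equal to $1$ when $S=\emptyset$), taking integer values at integers, such that $|P(S;n)|=p(n)\,2^{n-|S|-1}$ for every $n\ge 1$ with $S\subseteq[n-1]$. This $p$ is called the peak polynomial of $S$. Mirrored permutations of type $C_n$: $\mathcal{C}_n\subset\mathfrak{S}_{2n}$ is the subgroup of all $\pi_1\cdots\pi_n|\pi_{n+1}\cdots\pi_{2n}\in\mathfrak{S}_{2n}$ (the bar is only a visual separator) such that $\pi_{2n-i+1}=2n-\pi_i+1$ for all $i$. Mirrored permutations of type $D_n$: $\mathcal{D}_n\subset\mathcal{C}_n$ is the subgroup of those $\pi\in\mathcal{C}_n$ for which $\{\pi_1,\dots,\pi_n\}$ contains an even number of elements of $\{n+1,\dots,2n\}$.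 For $S\subseteq[n-1]$: $P_C(S;n)=\{\pi\in\mathcal{C}_n\mid P(\pi_1\cdots\pi_n)=S\}$ and $P_D(S;n)=\{\pi\in\mathcal{D}_n\mid P(\pi_1\cdots\pi_n)=S\}$. *)

(* Defs.v *)
From HB Require Import structures.
From mathcomp Require Import all_boot all_order all_fingroup all_algebra.
From mathcomp Require Import finmap.

Set Implicit Arguments.
Unset Strict Implicit.
Unset Printing Implicit Defensive.

Import Order.TTheory GRing.Theory Num.Theory.

(* [m] = {1, ..., m} *)
Definition bracket (m : nat) : {fset nat} := [fset i in iota 1 m]%fset.

(* Positions are numbered from 1, so w_i is [nth 0 w i.-1]; [iota 2 (r - 2)]
   is 2, ..., r - 1. *)
Definition peaks (w : seq nat) : {fset nat} :=
  [fset i in [seq i <- iota 2 (size w - 2) |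
      (nth 0 w i.-2 < nth 0 w i.-1) && (nth 0 w i < nth 0 w i.-1)]]%fset.

(* ['S_n] permutes {0, ..., n - 1}; positions and values are shifted by one. *)
Definition one_line (n : nat) (s : 'S_n) : seq nat :=
  [seq (nat_of_ord (s i)).+1 | i <- enum 'I_n].

Definition peak_class (S : {fset nat}) (n : nat) : {set 'S_n} :=
  [set s : 'S_n | peaks (one_line s) == S].

Definition n_admissible (S : {fset nat}) (n : nat) : Prop :=
  peak_class S n != set0.

(* The exponent n - |S| - 1 never truncates, since S is included in [n - 1].
   For nonempty S, [size p = max S] says that p has degree max(S) - 1. *)
Definition is_peak_polynomial (S : {fset nat}) (p : {poly rat}) : Prop :=
  [/\ S = fset0 -> p = 1%R,
      S <> fset0 -> size p = \max_(i <- S) i,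
      forall m : int, (p.[m%:~R])%R \is a Num.int
    & forall n : nat, 0 < n -> (S `<=` bracket n.-1)%fset ->
        (#|peak_class S n|%:R = p.[n%:R] * 2%:R ^+ (n - #|` S| - 1))%R].

(* Mirroring is pi_(2n-i+1) = 2n - pi_i + 1; on {0, ..., 2n - 1} the map
   k |-> 2n - k + 1 becomes [rev_ord]. *)
Definition mirrored_C (n : nat) : {set 'S_(2 * n)} :=
  [set s : 'S_(2 * n) | [forall i, s (rev_ord i) == rev_ord (s i)]].

(* With the shift by one, {n + 1, ..., 2n} is the set of j with n <= j. *)
Definition mirrored_D (n : nat) : {set 'S_(2 * n)} :=
  [set s in mirrored_C n |
     ~~ odd #|[set s i | i : 'I_(2 * n) & i < n] :&:
              [set j : 'I_(2 * n) | n <= j]|].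

Definition peak_class_C (S : {fset nat}) (n : nat) : {set 'S_(2 * n)} :=
  [set s in mirrored_C n | peaks (take n (one_line s)) == S].

Definition peak_class_D (S : {fset nat}) (n : nat) : {set 'S_(2 * n)} :=
  [set s in mirrored_D n | peaks (take n (one_line s)) == S].

(* Main.v *)
(** A mirrored permutation [pi] is determined by its first half, and the first
    half is determined by its set of values, which contains exactly one element
    of each mirror pair {j, 2n - j + 1}, together with its standardization in
    S_n.  Standardization preserves peaks, so each of the 2^n sets of values
    (2^(n-1) of them having evenly many large elements) contributes |P(S;n)|
    permutations. *)
Require Import Defs.
From HB Require Import structures.
From mathcomp Require Import all_boot all_order all_fingroup all_algebra.
From mathcomp Require Import finmap zify.

Set Implicit Arguments.
Unset Strict Implicit.
Unset Printing Implicit Defensive.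

Import Order.TTheory GRing.Theory Num.Theory.

(** * Peaks under order isomorphism, even subsets, preimages *)

Lemma eq_peaks (v w : seq nat) :
  size v = size w ->
  (forall i j, i < size v -> j < size v ->
     (nth 0 v i < nth 0 v j) = (nth 0 w i < nth 0 w j)) ->
  peaks v = peaks w.
Proof.
move=> svw vw; rewrite /peaks svw; apply/fsetP => i; rewrite !inE !mem_filter mem_iota.
(* For [i] in this range the three indices compared are all below the size, so the default of [nth]
   never matters. *)
by case: (boolP (2 <= i < _)) => hi; rewrite ?andbF // !vw // svw; lia.
Qed.

(** Toggling the membership of a fixed [x] is an involution exchanging even and odd subsets, so each
    kind makes up half of the power set. *)
Lemma card_even_sets (T : finType) :
  0 < #|T| -> #|[set B : {set T} | ~~ odd #|B|]| = 2 ^ #|T|.-1.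
Proof.
case/card_gt0P=> x _.
pose E := [set B : {set T} | ~~ odd #|B|].
pose f (B : {set T}) := if x \in B then B :\ x else x |: B.
have fK : involutive f.
  move=> B; rewrite /f; have [xB|xB] := boolP (x \in B).
    by rewrite setD11 setD1K.
  by rewrite setU11 setU1K.
have fE B : (f B \in E) = (B \notin E).
  rewrite !inE /f; case: ifP => xB.
    by rewrite [#|B|](cardsD1 x) xB /= negbK; case: (odd _).
  by rewrite cardsU1 xB /= negbK.
have eqE : f @^-1: E = ~: E by apply/setP => B; rewrite inE fE [RHS]inE.
have cE : #|~: E| = #|E| by rewrite -eqE card_preimset //; exact: inv_inj.
have T0 : 0 < #|T| by apply/card_gt0P; exists x.
have := cardsC E; rewrite cE -cardsT -powersetT card_powerset cardsT.
rewrite -[in 2 ^ _](prednK T0) expnS addnn -mul2n => /eqP.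
by rewrite eqn_pmul2l // => /eqP.
Qed.

(** Allows counting along [mirror], which is injective but reaches only the mirrored
    permutations. *)
Lemma card_preimset_onto (aT rT : finType) (f : aT -> rT) (A : {set rT}) :
  injective f -> {subset A <= codom f} -> #|f @^-1: A| = #|A|.
Proof.
move=> injf onto; rewrite -(card_imset _ injf); congr #|pred_of_set _|.
apply/setP => y; apply/imsetP/idP => [[x + ->]|yA]; first by rewrite inE.
by have /codomP[x eqy] := onto y yA; exists x; rewrite // inE -eqy.
Qed.

(** * Mirror pairs and the sets choosing one element of each *)

Section Signed.

Variable n : nat.

Definition low (i : 'I_n) : 'I_(2 * n) := widen_ord (@leq_pmull n 2 isT) i.

Lemma fold_subproof (x : 'I_(2 * n)) : (if x < n then x : nat else rev_ord x) < n.
Proof. by have := ltn_ord x; case: ifP => /=; lia. Qed.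

(** The index of the mirror pair containing [x]; it serves for positions as well as for values. *)
Definition fold (x : 'I_(2 * n)) : 'I_n := Ordinal (fold_subproof x).

Lemma low_inj : injective low.
Proof. by move=> i j /(congr1 val) /= /val_inj. Qed.

Lemma lowK : cancel low fold.
Proof. by move=> i; apply: val_inj; rewrite /= ltn_ord. Qed.

Lemma low_fold x : low (fold x) = if x < n then x else rev_ord x.
Proof. by apply: val_inj => /=; case: ifP. Qed.

Lemma rev_low_ge i : (rev_ord (low i) < n) = false.
Proof. by have := ltn_ord i; rewrite /=; lia. Qed.

Lemma low_rev i j : (low i == rev_ord (low j)) = false.
Proof.
by apply/eqP => /(congr1 (fun x : 'I__ => x < n)); rewrite rev_low_ge /= ltn_ord.
Qed.

Lemma fold_rev x : fold (rev_ord x) = fold x.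
Proof.
by apply: val_inj; have := ltn_ord x; rewrite /=; case: ifP; case: ifP; lia.
Qed.

Lemma ltn_rev (x : 'I_(2 * n)) : (rev_ord x < n) = ~~ (x < n).
Proof. by have := ltn_ord x; rewrite /=; lia. Qed.

(** [B] records the pairs whose large element is chosen, so that [values B] runs over all
    transversals of the mirror pairs. *)
Definition signed (B : {set 'I_n}) (j : 'I_n) : 'I_(2 * n) :=
  if j \in B then rev_ord (low j) else low j.

Definition values (B : {set 'I_n}) : {set 'I_(2 * n)} := [set signed B j | j : 'I_n].

Lemma fold_signed B : cancel (signed B) fold.
Proof. by move=> j; rewrite /signed; case: ifP; rewrite ?fold_rev lowK. Qed.

Lemma mem_values B x : (x \in values B) = (x == signed B (fold x)).
Proof.
apply/imsetP/eqP => [[j _ ->]|->]; first by rewrite fold_signed.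
by exists (fold x).
Qed.

Lemma rev_low_values B j : (rev_ord (low j) \in values B) = (j \in B).
Proof.
rewrite mem_values fold_rev lowK /signed; case: ifP => _; first exact: eqxx.
by rewrite eq_sym low_rev.
Qed.

Lemma values_inj : injective values.
Proof. by move=> B C BC; apply/setP => j; rewrite -!rev_low_values BC. Qed.

Lemma rev_notin_values B x : x \in values B -> rev_ord x \notin values B.
Proof.
rewrite !mem_values fold_rev => /eqP <-.
by apply/eqP => /(congr1 (fun y : 'I__ => y < n)); rewrite ltn_rev; case: (x < n).
Qed.

Lemma card_values B : #|values B| = n.
Proof. by rewrite card_imset ?card_ord //; exact: can_inj (fold_signed B). Qed.

(** The large elements of [values B] are the mirrors of [low j] for [j] in [B]; this turns the type
    D condition into the parity of [#|B|]. *)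
Lemma card_values_large B :
  #|values B :&: [set j : 'I_(2 * n) | n <= j]| = #|B|.
Proof.
rewrite -(card_imset (mem B) (inj_comp rev_ord_inj low_inj)).
congr #|pred_of_set _|; apply/setP => x; rewrite !inE.
apply/andP/imsetP => [[xB nx]|[j jB ->]].
  exists (fold x) => /=; last by rewrite low_fold ltnNge nx /= rev_ordK.
  by rewrite -(rev_low_values B) low_fold ltnNge nx /= rev_ordK.
by rewrite /= rev_low_values leqNgt (rev_low_ge j).
Qed.

(** * Undoing standardization by the increasing enumeration of a value set *)

Definition increasing (B : {set 'I_n}) (i : 'I_n) : 'I_(2 * n) :=
  Order.enum_val (cast_ord (esym (card_values B)) i).

Lemma increasing_values B i : increasing B i \in values B.
Proof. exact: Order.EnumVal.enum_valP. Qed.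

Lemma increasing_inj B : injective (increasing B).
Proof. by move=> i j /Order.EnumVal.enum_val_inj /cast_ord_inj. Qed.

Lemma increasing_onto B x : x \in values B -> exists i, increasing B i == x.
Proof.
move=> xB; exists (cast_ord (card_values B) (Order.enum_rank_in xB x)).
by rewrite /increasing cast_ordK Order.EnumVal.enum_rankK_in.
Qed.

Lemma ltn_increasing B i j : (increasing B i < increasing B j) = (i < j).
Proof.
have tot : total (<=%O : rel 'I_(2 * n)) by exact: le_total.
(* [le_enum_val] concerns the large order, so both strict comparisons become negated large ones,
   with [i] and [j] swapped. *)
rewrite !ltnNge; congr (~~ _).
exact: (@Order.le_enum_val _ _ tot (mem (values B)) (cast_ord _ j) (cast_ord _ i)).
Qed.

Definition mirror_fun (s : 'S_n) (B : {set 'I_n}) (x : 'I_(2 * n)) :=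
  let y := increasing B (s (fold x)) in if x < n then y else rev_ord y.

(** Inside one half, [s] and [increasing B] are injective; across the halves, a collision would put
    both elements of a mirror pair in [values B]. *)
Lemma mirror_fun_inj s B : injective (mirror_fun s B).
Proof.
have cross i j : increasing B i <> rev_ord (increasing B j).
  move=> eqij; have := rev_notin_values (increasing_values B j).
  by rewrite -eqij increasing_values.
move=> x y; rewrite /mirror_fun.
case: ifP => xn; case: ifP => yn.
- move=> /increasing_inj /perm_inj /(congr1 low).
  by rewrite !low_fold xn yn.
- by move/cross.
- by move/esym/cross.
- move=> /rev_ord_inj /increasing_inj /perm_inj /(congr1 low).
  by rewrite !low_fold xn yn => /rev_ord_inj.
Qed.

Definition mirror (sB : 'S_n * {set 'I_n}) : 'S_(2 * n) :=
  perm (@mirror_fun_inj sB.1 sB.2).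

Lemma mirror_low s B i : mirror (s, B) (low i) = increasing B (s i).
Proof. by rewrite permE /mirror_fun lowK /= ltn_ord. Qed.

Lemma mirror_rev sB x : mirror sB (rev_ord x) = rev_ord (mirror sB x).
Proof.
by rewrite !permE /mirror_fun fold_rev ltn_rev; case: (x < n); rewrite /= ?rev_ordK.
Qed.

(** * Bijectivity of [mirror] onto the mirrored permutations *)

Lemma first_half (s : 'S_(2 * n)) :
  [set s i | i : 'I_(2 * n) & i < n] = [set s (low i) | i : 'I_n].
Proof.
apply/setP => y; apply/imsetP/imsetP => [[x + ->]|[i _ ->]].
  by rewrite inE => xn; exists (fold x); rewrite // low_fold xn.
by exists (low i); rewrite // inE /= ltn_ord.
Qed.

Lemma first_half_mirror s B : [set mirror (s, B) (low i) | i : 'I_n] = values B.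
Proof.
apply/setP => y; apply/imsetP/idP => [[i _ ->]|yB].
  by rewrite mirror_low increasing_values.
have [i /eqP <-] := increasing_onto yB; exists ((s^-1)%g i) => //.
by rewrite mirror_low permKV.
Qed.

(** The values of the first half determine [B]; injectivity of [increasing B] then recovers [s]. *)
Lemma mirror_inj : injective mirror.
Proof.
move=> [s B] [t C] eqm.
have eqBC : B = C.
  by apply: values_inj; rewrite -(first_half_mirror s) eqm first_half_mirror.
rewrite -{}eqBC in eqm *; congr (_, _); apply/permP => i.
by apply: (@increasing_inj B); rewrite -!mirror_low eqm.
Qed.

Lemma mirrored_C_codom : {subset mirrored_C n <= codom mirror}.
Proof.
move=> p; rewrite inE => /forallP revp.
have {}revp x : p (rev_ord x) = rev_ord (p x) by apply/eqP.
pose V := [set p (low i) | i : 'I_n].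
pose B := [set j | rev_ord (low j) \in V].
have eqV : values B = V.
  (* Both sets have [n] elements, so one inclusion suffices. *)
  apply/eqP; rewrite eqEcard card_values card_imset ?card_ord; last first.
    exact: inj_comp perm_inj low_inj.
  rewrite leqnn andbT; apply/subsetP => _ /imsetP[j _ ->].
  rewrite /signed inE; case: ifP => // /negbT.
  (* If [low j] is not a value of the first half, its position [x] is in the second half; the
     mirrored position is then in the first half and carries [rev_ord (low j)]. *)
  apply: contraNT => jV; set x := (p^-1)%g (low j).
  apply/imsetP; exists (fold x) => //; rewrite low_fold.
  case: ifP => xn; last by rewrite revp permKV.
  case/imsetP: jV; exists (fold x) => //; rewrite low_fold xn.
  by rewrite permKV.
have ex i : exists k, increasing B k == p (low i).
  by apply: increasing_onto; rewrite eqV; apply: imset_f.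
(* [f i] is the rank of [p (low i)] in [values B]: [f] is the standardization of the first half. *)
pose f i := xchoose (ex i).
have fE i : increasing B (f i) = p (low i) by apply/eqP; exact: xchooseP (ex i).
have injf : injective f.
  by move=> i j eqf; apply/low_inj/(@perm_inj _ p); rewrite -!fE eqf.
apply/codomP; exists (perm injf, B); apply/permP => x.
have eqlow i : p (low i) = mirror (perm injf, B) (low i).
  by rewrite mirror_low permE fE.
have [xn|xn] := boolP (x < n).
  by rewrite -[x](_ : low (fold x) = _) ?eqlow // low_fold xn.
by rewrite -[x](_ : rev_ord (low (fold x)) = _) ?revp ?mirror_rev ?eqlow //
           low_fold (negbTE xn) rev_ordK.
Qed.

Lemma mirror_mirrored_C sB : mirror sB \in mirrored_C n.
Proof. by rewrite inE; apply/forallP => x; rewrite mirror_rev. Qed.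

Lemma mirror_mirrored_D s B : (mirror (s, B) \in mirrored_D n) = ~~ odd #|B|.
Proof.
by rewrite inE mirror_mirrored_C first_half first_half_mirror card_values_large.
Qed.

(** * Peaks of the first half, and the counts *)

Lemma take_one_line (s : 'S_(2 * n)) :
  take n (one_line s) = [seq (s (low i) : nat).+1 | i <- enum 'I_n].
Proof.
rewrite /one_line -map_take; suff -> : take n (enum 'I_(2 * n)) = map low (enum 'I_n).
  by rewrite -map_comp.
apply: (inj_map val_inj); rewrite map_take val_enum_ord -map_comp.
rewrite (eq_map (_ : val \o low =1 val)) // val_enum_ord take_iota.
by congr iota; lia.
Qed.

Lemma peaks_mirror s B : peaks (take n (one_line (mirror (s, B)))) = peaks (one_line s).
Proof.
rewrite take_one_line; apply: eq_peaks; first by rewrite !size_map.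
rewrite size_map size_enum_ord => i j ilt jlt.
have nthE (t : 'I_n -> nat) (k : 'I_n) : nth 0 [seq (t l).+1 | l <- enum 'I_n] k = (t k).+1.
  by rewrite (nth_map k) ?size_enum_ord // nth_ord_enum.
rewrite -[i]/(val (Ordinal ilt)) -[j]/(val (Ordinal jlt)) /one_line.
rewrite !(nthE (fun l => mirror (s, B) (low l))) !(nthE (fun l => s l)).
by rewrite !mirror_low !ltnS ltn_increasing.
Qed.

(** The preimage of the class under [mirror] is the product of [peak_class S n] with the power set
    of ['I_n]. *)
Lemma card_peak_class_C S : #|peak_class_C S n| = #|peak_class S n| * 2 ^ n.
Proof.
rewrite -(card_preimset_onto mirror_inj); last first.
  by move=> p; rewrite inE => /andP[/mirrored_C_codom].
rewrite -[in 2 ^ _](card_ord n) -cardsT -card_powerset -cardsX.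
congr #|pred_of_set _|; apply/setP => -[s B].
by rewrite [LHS]inE [LHS]inE mirror_mirrored_C peaks_mirror !inE subsetT andbT.
Qed.

(** As in type C, with only the even subsets of ['I_n]; they are half of all subsets because ['I_n]
    is nonempty. *)
Lemma card_peak_class_D S :
  0 < n -> #|peak_class_D S n| = #|peak_class S n| * 2 ^ n.-1.
Proof.
move=> n0; rewrite -(card_preimset_onto mirror_inj); last first.
  by move=> p; rewrite inE => /andP[]; rewrite inE => /andP[/mirrored_C_codom].
rewrite -[in n.-1](card_ord n) -card_even_sets ?card_ord // -cardsX.
congr #|pred_of_set _|; apply/setP => -[s B].
by rewrite inE [LHS]inE mirror_mirrored_D peaks_mirror !inE andbC.
Qed.

End Signed.

Theorem theorem24 (n : nat) (S : {fset nat}) (p : {poly rat})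
    (hn : 0 < n) (hS : (S `<=` bracket n.-1)%fset)
    (hadm : n_admissible S n) (hp : is_peak_polynomial S p) :
  (#|peak_class_C S n|%:R = p.[n%:R] * 2%:R ^+ (2 * n - #|` S| - 1))%R /\
  (#|peak_class_D S n|%:R = p.[n%:R] * 2%:R ^+ (2 * n - #|` S| - 2))%R.
Proof.
case: hp => _ _ _ cardP.
(* This bound keeps the natural subtractions in the exponents exact, so that [n - |S| - 1] plus [n],
   or plus [n.-1], gives the required exponent. *)
have leS : #|` S| <= n.-1.
  apply: leq_trans (fsubset_leq_card hS) _.
  by rewrite card_fseq (leq_trans (size_undup _)) // size_iota.
rewrite card_peak_class_C card_peak_class_D // !natrM cardP // !natrX -!mulrA -!exprD.
by split; congr (_ * _ ^+ _)%R; lia.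
Qed.
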